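(* Let $\underline{C}$ be a triangulated category endowed with a weight structure $w$ and a $t$-structure $t$ adjacent to $w$, and let $m\le n$ be integers. Let $\underline{C}_{w\notin[m,n]}$ be the class of objects of $\underline{C}$ without weights $m,\dots,n$, let $\operatorname{Mor}_{\mathrm{kill}[m,n]}\underline{C}$ be the class of morphisms of $\underline{C}$ that kill weights $m,\dots,n$, and let $\underline{C}[m,n]=\underline{C}_{t\le n}\cap\underline{C}_{t\ge m}$. Then the following statements are valid. 1. The couple $(\underline{C}_{w\notin[m,n]},\underline{C}[m,n])$ is a torsion theory on $\underline{C}$. 2. The couple $(\underline{C}_{w\notin[m,n]},\mathcal{J}_{[m,n]})$ is a projective class, where $\mathcal{J}_{[m,n]}$ is the class of those morphisms of $\underline{C}$ that factor through objects of $\underline{C}[m,n]$. 3. The couple $(\underline{C}[m,n],\operatorname{Mor}_{\mathrm{kill}[m,n]}\underline{C})$ is an injective class, and $\operatorname{Mor}_{\mathrm{kill}[m,n]}\underline{C}$ consists of those morphisms that factor through objects of $\underline{C}_{w\notin[m,n]}$.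
   Context: Notation: $\underline{C}(X,Y)$ is the set of morphisms from $X$ to $Y$. For classes $D,E$ of objects, $D^{\perp}=\{Y:\underline{C}(X,Y)=0\ \forall X\in D\}$ and ${}^{\perp}E=\{X:\underline{C}(X,Y)=0\ \forall Y\in E\}$. Torsion theory on $\underline{C}$: a couple $s=(\mathcal{LO},\mathcal{RO})$ of classes of objects of $\underline{C}$ with $\mathcal{LO}^{\perp}=\mathcal{RO}$, $\mathcal{LO}={}^{\perp}\mathcal{RO}$, and such that every object $M$ fits in a distinguished triangle $L_sM\to M\to R_sM\to L_sM[1]$ with $L_sM\in\mathcal{LO}$, $R_sM\in\mathcal{RO}$. Weight structure: if $\mathcal{LO}\subset\mathcal{LO}[1]$ for a torsion theory $(\mathcal{LO},\mathcal{RO})$, the couple $w=(\underline{C}_{w\le 0},\underline{C}_{w\ge 0})=(\mathcal{LO},\mathcal{RO}[-1])$ is called a weight structure. Set $\underline{C}_{w\le k}=\underline{C}_{w\le 0}[k]$ and $\underline{C}_{w\ge k}=\underline{C}_{w\ge 0}[k]$ for $k\in\mathbb{Z}$. $t$-structure (homological convention): if $\mathcal{LO}\subset\mathcal{LO}[-1]$ for a torsion theory $(\mathcal{LO},\mathcal{RO})$, the couple $t=(\underline{C}_{t\le 0},\underline{C}_{t\ge 0})$ with $\underline{C}_{t\le 0}=\mathcal{RO}[1]$ and $\underline{C}_{t\ge 0}=\mathcal{LO}$ is called a $t$-structure. Set $\underline{C}_{t\le k}=\underline{C}_{t\le 0}[k]$ and $\underline{C}_{t\ge k}=\underline{C}_{t\ge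 0}[k]$. The structures $w$ and $t$ are adjacent if $\underline{C}_{w\ge 0}=\underline{C}_{t\ge 0}$. Weight decompositions: a $k$-weight decomposition of $X$ is a distinguished triangle $w_{\le k}X\to X\to w_{\ge k+1}X\to (w_{\le k}X)[1]$ with $w_{\le k}X\in\underline{C}_{w\le k}$ and $w_{\ge k+1}X\in\underline{C}_{w\ge k+1}$ (it exists but is not canonical). Killing weights: $g\in\underline{C}(M,N)$ kills weights $m,\dots,n$ if for some (equivalently, for any) choice of $w_{\le n}M$ and $w_{\ge m}N$ (coming from weight decompositions of $M$ and $N$) the composition $w_{\le n}M\to M\stackrel{g}{\to}N\to w_{\ge m}N$ is zero. An object $M$ is without weights $m,\dots,n$ if $\operatorname{id}_M$ kills weights $m,\dots,n$. Projective class: for a class $\mathcal{P}$ of objects, a morphism $h$ is $\mathcal{P}$-null if $\underline{C}(M,h)=0$ for all $M\in\mathcal{P}$. A couple $(\mathcal{P},\mathcal{J})$ with $\mathcal{P}\subset\operatorname{Obj}\underline{C}$, $\mathcal{J}\subset\operatorname{Mor}(\underline{C})$ is a projective class if: (i) $\mathcal{J}$ is the class of all $\mathcal{P}$-null morphisms; (ii) for $M\in\operatorname{Obj}\underline{C}$, the functor $\underline{C}(M,-)$ annihilates all elements of $\mathcal{J}$ if and only if $M\in\mathcal{P}$; (iii) for any $M\in\operatorname{Obj}\underline{C}$ there is a distinguished triangle $PM\to M\stackrel{j}{\to} IM\to PM[1]$ with $PM\in\mathcal{P}$ and $j\in\mathcal{J}$. The couple $(\mathcal{P},\mathcal{J})$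 is an injective class if it is a projective class in the opposite category $\underline{C}^{op}$. *)

(* Defs.v *)
From HB Require Import structures.
From mathcomp Require Import all_boot all_order all_algebra.
From mathcomp Require Import boolp classical_sets.

Set Implicit Arguments.
Unset Strict Implicit.
Unset Printing Implicit Defensive.

Import Order.TTheory GRing.Theory Num.Theory.
Local Open Scope classical_set_scope.
Local Open Scope ring_scope.

(* The data of a triangulated category, separated from the axioms so that the
   opposite is defined by duality alone.  The shift is an autoequivalence and
   not necessarily a strict automorphism: X[-1] is [unshift X], for a chosen
   quasi-inverse with its unit and counit (and their inverses). *)
Record triData := TriData {
  obj :> Type;
  mor : obj -> obj -> zmodType;
  idm : forall X : obj, mor X X;
  ccomp : forall X Y Z : obj, mor Y Z -> mor X Y -> mor X Z;
  shift : obj -> obj;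
  shift_map : forall X Y : obj, mor X Y -> mor (shift X) (shift Y);
  unshift : obj -> obj;
  unshift_map : forall X Y : obj, mor X Y -> mor (unshift X) (unshift Y);
  sunit : forall X : obj, mor X (unshift (shift X));
  sunitV : forall X : obj, mor (unshift (shift X)) X;
  scounit : forall X : obj, mor (shift (unshift X)) X;
  scounitV : forall X : obj, mor X (shift (unshift X));
  distinguished : forall X Y Z : obj,
    mor X Y -> mor Y Z -> mor Z (shift X) -> Prop
}.

Arguments mor {t} X Y.
Arguments idm {t} X.
Arguments ccomp {t X Y Z} g f.
Arguments shift {t} X.
Arguments shift_map {t X Y} f.
Arguments unshift {t} X.
Arguments unshift_map {t X Y} f.
Arguments sunit {t} X.
Arguments sunitV {t} X.
Arguments scounit {t} X.
Arguments scounitV {t} X.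
Arguments distinguished {t X Y Z} f g h.

Notation "g \oc f" := (ccomp g f) (at level 40, left associativity).

Definition is_iso (C : triData) (X Y : C) (f : mor X Y) : Prop :=
  exists g : mor Y X, g \oc f = idm X /\ f \oc g = idm Y.

Definition isomorphic (C : triData) (X Y : C) : Prop :=
  exists f : mor X Y, is_iso f.

Definition is_zero_obj (C : triData) (X : C) : Prop := idm X = 0.

Record additive_axioms (C : triData) : Prop := {
  comp_assoc : forall (X Y Z T : C) (h : mor Z T) (g : mor Y Z) (f : mor X Y),
    h \oc (g \oc f) = (h \oc g) \oc f;
  comp_idl : forall (X Y : C) (f : mor X Y), idm Y \oc f = f;
  comp_idr : forall (X Y : C) (f : mor X Y), f \oc idm X = f;
  comp_addl : forall (X Y Z : C) (g g' : mor Y Z) (f : mor X Y),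
    (g + g') \oc f = g \oc f + g' \oc f;
  comp_addr : forall (X Y Z : C) (g : mor Y Z) (f f' : mor X Y),
    g \oc (f + f') = g \oc f + g \oc f';
  zero_obj_ex : exists X : C, is_zero_obj X;
  biproduct_ex : forall X Y : C, exists (B : C)
    (i1 : mor X B) (i2 : mor Y B) (p1 : mor B X) (p2 : mor B Y),
    [/\ p1 \oc i1 = idm X, p2 \oc i2 = idm Y, p1 \oc i2 = 0, p2 \oc i1 = 0
      & i1 \oc p1 + i2 \oc p2 = idm B]
}.

Record shift_axioms (C : triData) : Prop := {
  shift_map_id : forall X : C, shift_map (idm X) = idm (shift X);
  shift_map_comp : forall (X Y Z : C) (g : mor Y Z) (f : mor X Y),
    shift_map (g \oc f) = shift_map g \oc shift_map f;
  shift_map_add : forall (X Y : C) (f f' : mor X Y),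
    shift_map (f + f') = shift_map f + shift_map f';
  unshift_map_id : forall X : C, unshift_map (idm X) = idm (unshift X);
  unshift_map_comp : forall (X Y Z : C) (g : mor Y Z) (f : mor X Y),
    unshift_map (g \oc f) = unshift_map g \oc unshift_map f;
  unshift_map_add : forall (X Y : C) (f f' : mor X Y),
    unshift_map (f + f') = unshift_map f + unshift_map f';
  sunitK : forall X : C, sunitV X \oc sunit X = idm X;
  sunitVK : forall X : C, sunit X \oc sunitV X = idm (unshift (shift X));
  scounitK : forall X : C, scounitV X \oc scounit X = idm (shift (unshift X));
  scounitVK : forall X : C, scounit X \oc scounitV X = idm X;
  sunit_nat : forall (X Y : C) (f : mor X Y),
    unshift_map (shift_map f) \oc sunit X = sunit Y \oc f;
  scounit_nat : forall (X Y : C) (f : mor X Y),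
    f \oc scounit X = scounit Y \oc shift_map (unshift_map f);
  shift_triangle : forall X : C,
    scounit (shift X) \oc shift_map (sunit X) = idm (shift X);
  unshift_triangle : forall X : C,
    unshift_map (scounit X) \oc sunit (unshift X) = idm (unshift X)
}.

Record verdier_axioms (C : triData) : Prop := {
  dist_iso : forall (X Y Z X' Y' Z' : C)
    (f : mor X Y) (g : mor Y Z) (h : mor Z (shift X))
    (f' : mor X' Y') (g' : mor Y' Z') (h' : mor Z' (shift X'))
    (a : mor X X') (b : mor Y Y') (c : mor Z Z'),
    is_iso a -> is_iso b -> is_iso c ->
    f' \oc a = b \oc f -> g' \oc b = c \oc g -> h' \oc c = shift_map a \oc h ->
    distinguished f g h -> distinguished f' g' h';
  dist_id : forall X Z : C, is_zero_obj Z ->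
    distinguished (idm X) (0 : mor X Z) (0 : mor Z (shift X));
  dist_cone : forall (X Y : C) (f : mor X Y),
    exists (Z : C) (g : mor Y Z) (h : mor Z (shift X)), distinguished f g h;
  dist_rotate : forall (X Y Z : C)
    (f : mor X Y) (g : mor Y Z) (h : mor Z (shift X)),
    distinguished f g h <-> distinguished g h (- shift_map f);
  dist_fill : forall (X Y Z X' Y' Z' : C)
    (f : mor X Y) (g : mor Y Z) (h : mor Z (shift X))
    (f' : mor X' Y') (g' : mor Y' Z') (h' : mor Z' (shift X'))
    (a : mor X X') (b : mor Y Y'),
    distinguished f g h -> distinguished f' g' h' -> f' \oc a = b \oc f ->
    exists c : mor Z Z', g' \oc b = c \oc g /\ h' \oc c = shift_map a \oc h;
  dist_octahedron : forall (X Y Z U V W : C) (f : mor X Y) (g : mor Y Z)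
    (a1 : mor Y U) (b1 : mor U (shift X))
    (a2 : mor Z V) (b2 : mor V (shift Y))
    (a3 : mor Z W) (b3 : mor W (shift X)),
    distinguished f a1 b1 -> distinguished g a2 b2 ->
    distinguished (g \oc f) a3 b3 ->
    exists (u : mor U W) (v : mor W V),
      [/\ distinguished u v (shift_map a1 \oc b2),
          u \oc a1 = a3 \oc g, b3 \oc u = b1,
          v \oc a3 = a2 & b2 \oc v = shift_map f \oc b3]
}.

Record triangulatedCategory := TriangulatedCategory {
  tri_data :> triData;
  tri_additive : additive_axioms tri_data;
  tri_shift : shift_axioms tri_data;
  tri_verdier : verdier_axioms tri_data
}.

(* In the opposite category [1] is the old [-1], and a candidate triangle
   X -f-> Y -g-> Z -h-> X[-1] (arrows of the opposite) is distinguished when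
   Z -g-> Y -f-> X ~= X[-1][1] -h[1]-> Z[1] is distinguished in C. *)
Definition opposite (C : triData) : triData := {|
  obj := obj C;
  mor X Y := mor Y X;
  idm X := idm X;
  ccomp X Y Z g f := f \oc g;
  shift := @unshift C;
  shift_map X Y f := unshift_map f;
  unshift := @shift C;
  unshift_map X Y f := shift_map f;
  sunit X := scounit X;
  sunitV X := scounitV X;
  scounit X := sunit X;
  scounitV X := sunitV X;
  distinguished X Y Z f g h := distinguished g f (shift_map h \oc scounitV X)
|}.

Definition shiftz (C : triData) (k : int) : C -> C :=
  match k with
  | Posz n => iter n shift
  | Negz n => iter n.+1 unshift
  end.

(* P[k], closed under isomorphism because the shift is only an
   autoequivalence. *)
Definition shift_class (C : triData) (P : set C) (k : int) : set C :=
  [set X | exists2 Y : C, P Y & isomorphic X (shiftz k Y)].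

Definition rperp (C : triData) (D : set C) : set C :=
  [set Y | forall X : C, D X -> forall f : mor X Y, f = 0].

Definition lperp (C : triData) (E : set C) : set C :=
  [set X | forall Y : C, E Y -> forall f : mor X Y, f = 0].

Record torsion_theory (C : triData) (LO RO : set C) : Prop := {
  torsion_right : rperp LO = RO;
  torsion_left : LO = lperp RO;
  torsion_dec : forall M : C, exists (L R : C)
    (a : mor L M) (b : mor M R) (c : mor R (shift L)),
    [/\ LO L, RO R & distinguished a b c]
}.

Record weight_structure (C : triData) := WeightStructure {
  w_le0 : set C;
  w_ge0 : set C;
  w_torsion : exists LO RO : set C,
    [/\ torsion_theory LO RO, LO `<=` shift_class LO 1,
        w_le0 = LO & w_ge0 = shift_class RO (-1)]
}.

Record t_structure (C : triData) := TStructure {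
  t_le0 : set C;
  t_ge0 : set C;
  t_torsion : exists LO RO : set C,
    [/\ torsion_theory LO RO, LO `<=` shift_class LO (-1),
        t_le0 = shift_class RO 1 & t_ge0 = LO]
}.

Definition w_le (C : triData) (w : weight_structure C) (k : int) : set C :=
  shift_class (w_le0 w) k.

Definition w_ge (C : triData) (w : weight_structure C) (k : int) : set C :=
  shift_class (w_ge0 w) k.

Definition t_le (C : triData) (t : t_structure C) (k : int) : set C :=
  shift_class (t_le0 t) k.

Definition t_ge (C : triData) (t : t_structure C) (k : int) : set C :=
  shift_class (t_ge0 t) k.

Definition adjacent (C : triData) (w : weight_structure C) (t : t_structure C)
  : Prop := w_ge0 w = t_ge0 t.

Definition weight_decomposition (C : triData) (w : weight_structure C)
    (k : int) (X A B : C) (a : mor A X) (b : mor X B) (c : mor B (shift A))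
  : Prop :=
  [/\ w_le w k A, w_ge w (k + 1) B & distinguished a b c].

Definition mor_class (C : triData) := forall X Y : C, set (mor X Y).

(* The quotient N -> w_{>= m} N comes from an (m-1)-weight decomposition. *)
Definition kills_weights (C : triData) (w : weight_structure C) (m n : int)
  : mor_class C := fun M N => [set g |
  exists (A B : C) (a : mor A M) (b : mor M B) (c : mor B (shift A))
         (A' B' : C) (a' : mor A' N) (b' : mor N B') (c' : mor B' (shift A')),
    [/\ weight_decomposition w n a b c,
        weight_decomposition w (m - 1) a' b' c'
      & b' \oc g \oc a = 0]].

Definition without_weights (C : triData) (w : weight_structure C) (m n : int)
  : set C := [set M | kills_weights w m n (idm M)].

Definition t_range (C : triData) (t : t_structure C) (m n : int) : set C :=
  t_le t n `&` t_ge t m.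

Definition factors_through (C : triData) (P : set C) : mor_class C :=
  fun X Y => [set h | exists Z : C, P Z /\
    exists (f : mor X Z) (g : mor Z Y), h = g \oc f].

Definition annihilated_by (C : triData) (M X Y : C) (h : mor X Y) : Prop :=
  forall f : mor M X, h \oc f = 0.

Record projective_class (C : triData) (P : set C) (J : mor_class C) : Prop := {
  proj_null : forall (X Y : C) (h : mor X Y),
    J X Y h <-> (forall M : C, P M -> annihilated_by M h);
  proj_obj : forall M : C,
    (forall (X Y : C) (h : mor X Y), J X Y h -> annihilated_by M h) <-> P M;
  proj_dec : forall M : C, exists (PM IM : C)
    (i : mor PM M) (j : mor M IM) (d : mor IM (shift PM)),
    [/\ P PM, J M IM j & distinguished i j d]
}.

Definition injective_class (C : triData) (P : set C) (J : mor_class C) : Prop :=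
  @projective_class (opposite C) P (fun X Y => J Y X).

(* Main.v *)
Require Import Defs.
From HB Require Import structures.
From mathcomp Require Import all_boot all_order all_algebra.
From mathcomp Require Import boolp classical_sets.

(** Everything follows from one description of the morphisms that kill
    weights (lemma [kills_weightsP]): g : M -> N kills weights m, ..., n if and
    only if h g = 0 for every h : N -> Y with Y in the range C[m,n].  Indeed,
    such a Y lies in w_{>= m}, so h factors through N -> w_{>= m} N, and it lies
    in t_{<= n}, so it receives no map from w_{>= n+1} M.  Conversely, by
    adjacency w_{>= m} N can be truncated by t; its truncation
    Q = t_{<= n} (w_{>= m} N) still lies in t_{>= m}, so M -> N -> Q is zero and
    M -> w_{>= m} N factors through t_{>= n+1} (w_{>= m} N), which lies in
    w_{>= n+1} and so receives no map from w_{<= n} M.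

    Applied to identities, this says that the objects without weights
    m, ..., n are exactly the left orthogonal of C[m,n].  For any M, the fibre
    of the composite M -> w_{>= m} M -> Q is, by the octahedral axiom, an
    extension of an object of t_{>= n+1} by an object of w_{<= m-1}, and both
    are left orthogonal to C[m,n]; this gives the decompositions
    (lemma [range_decomposition]), and hence the torsion theory, by the
    criterion [torsion_theoryI].

    Finally, any torsion theory (LO, RO) yields a projective class
    (LO, morphisms factoring through RO) and an injective class
    (RO, morphisms factoring through LO), because a map killed by L_M -> M
    factors through M -> R_M, and dually. *)

Set Implicit Arguments.
Unset Strict Implicit.
Unset Printing Implicit Defensive.

Import Order.TTheory GRing.Theory Num.Theory.
Local Open Scope classical_set_scope.
Local Open Scope ring_scope.

(** * Composition and shift *)

Lemma ocA (C : triangulatedCategory) (X Y Z T : C) (h : mor Z T) (g : mor Y Z)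
  (f : mor X Y) : h \oc (g \oc f) = h \oc g \oc f.
Proof. exact: comp_assoc (tri_additive C) _ _ _ _ _ _ _. Qed.

Lemma oc1m (C : triangulatedCategory) (X Y : C) (f : mor X Y) :
  idm Y \oc f = f.
Proof. exact: comp_idl (tri_additive C) _ _ _. Qed.

Lemma ocm1 (C : triangulatedCategory) (X Y : C) (f : mor X Y) :
  f \oc idm X = f.
Proof. exact: comp_idr (tri_additive C) _ _ _. Qed.

Lemma oc0m (C : triangulatedCategory) (X Y Z : C) (f : mor X Y) :
  (0 : mor Y Z) \oc f = 0.
Proof.
by apply: (addrI (0 \oc f)); rewrite -(comp_addl (tri_additive C)) !addr0.
Qed.

Lemma ocm0 (C : triangulatedCategory) (X Y Z : C) (g : mor Y Z) :
  g \oc (0 : mor X Y) = 0.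
Proof.
by apply: (addrI (g \oc 0)); rewrite -(comp_addr (tri_additive C)) !addr0.
Qed.

Lemma ocNm (C : triangulatedCategory) (X Y Z : C) (g : mor Y Z) (f : mor X Y) :
  (- g) \oc f = - (g \oc f).
Proof.
by apply: (addrI (g \oc f)); rewrite -(comp_addl (tri_additive C)) !subrr oc0m.
Qed.

Lemma ocmN (C : triangulatedCategory) (X Y Z : C) (g : mor Y Z) (f : mor X Y) :
  g \oc (- f) = - (g \oc f).
Proof.
by apply: (addrI (g \oc f)); rewrite -(comp_addr (tri_additive C)) !subrr ocm0.
Qed.

Lemma shift_map0 (C : triangulatedCategory) (X Y : C) :
  shift_map (0 : mor X Y) = 0.
Proof.
apply: (addrI (shift_map 0)).
by rewrite -(shift_map_add (tri_shift C)) !addr0.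
Qed.

Lemma shift_mapN (C : triangulatedCategory) (X Y : C) (f : mor X Y) :
  shift_map (- f) = - shift_map f.
Proof.
apply: (addrI (shift_map f)).
by rewrite -(shift_map_add (tri_shift C)) !subrr shift_map0.
Qed.

Lemma shift_mapM (C : triangulatedCategory) (X Y Z : C) (g : mor Y Z)
  (f : mor X Y) : shift_map (g \oc f) = shift_map g \oc shift_map f.
Proof. exact: shift_map_comp (tri_shift C) _ _ _ _ _. Qed.

Lemma shift_map_inj (C : triangulatedCategory) (X Y : C) :
  injective (@shift_map C X Y).
Proof.
move=> f g fg; have S := tri_shift C.
rewrite -[f]oc1m -[g]oc1m -(sunitK S) -!ocA.
by rewrite -!(sunit_nat S) fg.
Qed.

(** The adjunct of c under the adjoint equivalence between [1] and [-1];
    it turns connecting maps R -> L[1] into maps R[-1] -> L. *)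
Definition adjunct (C : triData) (L R : C) (c : mor R (shift L)) :
  mor (unshift R) L := sunitV L \oc unshift_map c.

Lemma adjunctK (C : triangulatedCategory) (L R : C) (c : mor R (shift L)) :
  shift_map (adjunct c) \oc scounitV R = c.
Proof.
have S := tri_shift C.
(* scounitV is natural, being inverse to the natural scounit. *)
have nat_c : shift_map (unshift_map c) \oc scounitV R
             = scounitV (shift L) \oc c.
  rewrite -[LHS]oc1m -(scounitK S) -ocA; congr (_ \oc _).
  by rewrite ocA -(scounit_nat S) -ocA (scounitVK S) ocm1.
(* By the triangle identity both maps invert shift_map (sunit L). *)
have inv_c : shift_map (sunitV L) = scounit (shift L).
  rewrite -[RHS]ocm1 -(shift_map_id S) -(sunitVK S) shift_mapM ocA.
  by rewrite (shift_triangle S) oc1m.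
by rewrite /adjunct shift_mapM -ocA nat_c inv_c ocA (scounitVK S) oc1m.
Qed.

Lemma shift_map_full (C : triangulatedCategory) (X Y : C)
  (c : mor (shift X) (shift Y)) : exists f : mor X Y, c = shift_map f.
Proof.
have S := tri_shift C.
exists (adjunct c \oc sunit X); rewrite shift_mapM.
have -> : shift_map (sunit X) = scounitV (shift X).
  rewrite -[LHS]oc1m -(scounitK S) -ocA.
  by rewrite (shift_triangle S) ocm1.
by rewrite adjunctK.
Qed.

(** * Isomorphisms, retracts and vanishing of morphism groups *)

Definition retract (C : triData) (X Y : C) : Prop :=
  exists (i : mor X Y) (p : mor Y X), p \oc i = idm X.

Definition retract_closed (C : triData) (P : set C) : Prop :=
  forall X Y : C, retract X Y -> P Y -> P X.

Definition hom_vanishes (C : triData) (X Y : C) : Prop :=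
  forall f : mor X Y, f = 0.

Lemma iso_refl (C : triangulatedCategory) (X : C) : isomorphic X X.
Proof. by exists (idm X), (idm X); rewrite oc1m. Qed.

Lemma iso_sym (C : triangulatedCategory) (X Y : C) :
  isomorphic X Y -> isomorphic Y X.
Proof. by case=> f [g [gf fg]]; exists g, f. Qed.

Lemma iso_trans (C : triangulatedCategory) (Y X Z : C) :
  isomorphic X Y -> isomorphic Y Z -> isomorphic X Z.
Proof.
case=> f [g [gf fg]] [f' [g' [gf' fg']]].
exists (f' \oc f), (g \oc g'); split.
  by rewrite -ocA (ocA g') gf' oc1m.
by rewrite -ocA (ocA f) fg oc1m.
Qed.

Lemma iso_retract (C : triangulatedCategory) (X Y : C) :
  isomorphic X Y -> retract X Y.
Proof. by case=> f [g [gf _]]; exists f, g. Qed.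

Lemma retract_trans (C : triangulatedCategory) (Y X Z : C) :
  retract X Y -> retract Y Z -> retract X Z.
Proof.
case=> i [p pi] [i' [p' pi']]; exists (i' \oc i), (p \oc p').
by rewrite -ocA (ocA p') pi' oc1m.
Qed.

Lemma iso_shift (C : triangulatedCategory) (X Y : C) :
  isomorphic X Y -> isomorphic (shift X) (shift Y).
Proof.
case=> f [g [gf fg]]; exists (shift_map f), (shift_map g).
by rewrite -!shift_mapM gf fg !(shift_map_id (tri_shift C)).
Qed.

Lemma iso_unshift (C : triangulatedCategory) (X Y : C) :
  isomorphic X Y -> isomorphic (unshift X) (unshift Y).
Proof.
have S := tri_shift C.
case=> f [g [gf fg]]; exists (unshift_map f), (unshift_map g).
by rewrite -!(unshift_map_comp S) gf fg !(unshift_map_id S).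
Qed.

Lemma iso_scounit (C : triangulatedCategory) (X : C) :
  isomorphic (shift (unshift X)) X.
Proof.
have S := tri_shift C.
by exists (scounit X), (scounitV X); rewrite (scounitK S) (scounitVK S).
Qed.

Lemma iso_sunit (C : triangulatedCategory) (X : C) :
  isomorphic (unshift (shift X)) X.
Proof.
have S := tri_shift C.
by exists (sunitV X), (sunit X); rewrite (sunitK S) (sunitVK S).
Qed.

Lemma hom_vanishes_retract (C : triangulatedCategory) (X' X Y' Y : C) :
  retract X' X -> retract Y' Y -> hom_vanishes X Y -> hom_vanishes X' Y'.
Proof.
case=> i [p pi] [j [q qj]] XY f.
rewrite -[f]oc1m -[f]ocm1 -qj -pi -ocA.
have -> : j \oc (f \oc (p \oc i)) = j \oc f \oc p \oc i by rewrite !ocA.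
by rewrite (XY (j \oc f \oc p)) oc0m ocm0.
Qed.

Lemma hom_vanishes_shift (C : triangulatedCategory) (X Y : C) :
  hom_vanishes (shift X) (shift Y) <-> hom_vanishes X Y.
Proof.
split=> XY f; first by apply: shift_map_inj; rewrite shift_map0.
by have [g ->] := shift_map_full f; rewrite (XY g) shift_map0.
Qed.

Lemma hom_vanishes_shiftz (C : triangulatedCategory) (k : int) (X Y : C) :
  hom_vanishes X Y -> hom_vanishes (shiftz k X) (shiftz k Y).
Proof.
have unshiftP (A B : C) :
  hom_vanishes A B -> hom_vanishes (unshift A) (unshift B).
  move=> AB; apply/hom_vanishes_shift.
  by apply: hom_vanishes_retract AB; apply: iso_retract; apply: iso_scounit.
case: k => k XY /=.
  by elim: k => //= k IHk; apply/hom_vanishes_shift.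
by apply/unshiftP; elim: k => //= k; apply: unshiftP.
Qed.

Lemma iso_shiftz (C : triangulatedCategory) (k : int) (X Y : C) :
  isomorphic X Y -> isomorphic (shiftz k X) (shiftz k Y).
Proof.
case: k => k XY /=; first by elim: k => //= k; apply: iso_shift.
by apply: iso_unshift; elim: k => //= k; apply: iso_unshift.
Qed.

Lemma retract_shiftz (C : triangulatedCategory) (k : int) (X Y : C) :
  retract X Y -> retract (shiftz k X) (shiftz k Y).
Proof.
have S := tri_shift C.
have shiftP (A B : C) : retract A B -> retract (shift A) (shift B).
  case=> i [p pi]; exists (shift_map i), (shift_map p).
  by rewrite -shift_mapM pi (shift_map_id S).
have unshiftP (A B : C) : retract A B -> retract (unshift A) (unshift B).
  case=> i [p pi]; exists (unshift_map i), (unshift_map p).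
  by rewrite -(unshift_map_comp S) pi (unshift_map_id S).
case: k => k XY /=; first by elim: k => //= k; apply: shiftP.
by apply/unshiftP; elim: k => //= k; apply: unshiftP.
Qed.

Lemma shiftz_succ (C : triangulatedCategory) (k : int) (X : C) :
  isomorphic (shift (shiftz k X)) (shiftz (k + 1) X).
Proof.
case: k => [k|[|k]].
- by rewrite -PoszD addn1; apply: iso_refl.
- exact: iso_scounit.
- have -> : Negz k.+1 + 1 = Negz k by rewrite !NegzE -addn1 PoszD opprD addrNK.
  exact: iso_scounit.
Qed.

Lemma shiftz_pred (C : triangulatedCategory) (k : int) (X : C) :
  isomorphic (unshift (shiftz k X)) (shiftz (k - 1) X).
Proof.
case: k => [[|k]|k].
- exact: iso_refl.
- have -> : Posz k.+1 - 1 = Posz k by rewrite -addn1 PoszD addrK.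
  exact: iso_sunit.
- have -> : Negz k - 1 = Negz k.+1 by rewrite !NegzE -[k.+2]addn1 PoszD opprD.
  exact: iso_refl.
Qed.

Lemma shiftzD (C : triangulatedCategory) (k j : int) (X : C) :
  isomorphic (shiftz k (shiftz j X)) (shiftz (k + j) X).
Proof.
elim/int_ind: k => [|k IHk|k IHk]; first by rewrite add0r; apply: iso_refl.
  have -> : Posz k.+1 + j = Posz k + j + 1 by rewrite -addn1 PoszD addrAC.
  exact: iso_trans (iso_shift IHk) (shiftz_succ _ _).
have -> : - Posz k.+1 + j = - Posz k + j - 1.
  by rewrite -addn1 PoszD opprD addrAC.
apply: iso_trans (iso_trans (iso_unshift IHk) (shiftz_pred _ _)).
rewrite -addn1 PoszD opprD; apply: iso_sym; exact: shiftz_pred.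
Qed.

Lemma shift_classD (C : triangulatedCategory) (P : set C) (k j : int) :
  shift_class (shift_class P j) k = shift_class P (k + j).
Proof.
rewrite eqEsubset; split=> X.
  case=> Y [Z PZ YZ] XY; exists Z => //.
  by apply: iso_trans XY (iso_trans (iso_shiftz k YZ) _); apply: shiftzD.
case=> Z PZ XZ; exists (shiftz j Z); first by exists Z => //; apply: iso_refl.
by apply: iso_trans XZ (iso_sym _); apply: shiftzD.
Qed.

Lemma shift_classS (C : triangulatedCategory) (P Q : set C) (k : int) :
  P `<=` Q -> shift_class P k `<=` shift_class Q k.
Proof. by move=> PQ X [Y PY XY]; exists Y => //; apply: PQ. Qed.

(** * Distinguished triangles *)

(** A weak cokernel property of distinguished triangles: compare with the
    triangle 0 -> T = T -> 0[1]. *)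
Lemma dist_factor_right (C : triangulatedCategory) (X Y Z T : C)
  (a : mor X Y) (b : mor Y Z) (c : mor Z (shift X)) (f : mor Y T) :
  distinguished a b c -> f \oc a = 0 -> exists g : mor Z T, f = g \oc b.
Proof.
move=> abc fa; have V := tri_verdier C.
have [O O0] := zero_obj_ex (tri_additive C).
have sO0 : is_zero_obj (shift O).
  by rewrite /is_zero_obj -(shift_map_id (tri_shift C)) O0 shift_map0.
have T0 : distinguished (0 : mor O T) (idm T) (0 : mor T (shift O)).
  by apply/(dist_rotate V); rewrite shift_map0 oppr0; apply: dist_id V _ _ sO0.
have [|g [fg _]] := dist_fill V (a := 0) (b := f) abc T0.
  by rewrite ocm0 fa.
by exists g; rewrite -fg oc1m.
Qed.

(** The weak kernel property.  Comparing with the rotated triangle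
    T -> 0 -> T[1] yields a lift only after shifting, which the full
    faithfulness of [1] undoes. *)
Lemma dist_factor_left (C : triangulatedCategory) (X Y Z T : C)
  (a : mor X Y) (b : mor Y Z) (c : mor Z (shift X)) (f : mor T Y) :
  distinguished a b c -> b \oc f = 0 -> exists g : mor T X, f = a \oc g.
Proof.
move=> abc bf; have V := tri_verdier C.
have [O O0] := zero_obj_ex (tri_additive C).
have T0 := (dist_rotate V _ _ _).1 (dist_id V T O0).
have [|k [_ ak]] :=
  dist_fill V (a := f) (b := 0) T0 ((dist_rotate V _ _ _).1 abc).
  by rewrite bf oc0m.
have [g kg] := shift_map_full k; exists g; apply: shift_map_inj.
move: ak; rewrite (shift_map_id (tri_shift C)) ocmN ocm1 ocNm kg => /oppr_inj.
by rewrite -shift_mapM => <-.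
Qed.

(** Rotating a triangle backwards: W must be replaced by W[-1][1]. *)
Lemma dist_rotateV (C : triangulatedCategory) (Y Z W : C) (g : mor Y Z)
  (u : mor Z W) (v : mor W (shift Y)) : distinguished g u v ->
  exists (f : mor (unshift W) Y) (h : mor Z (shift (unshift W))),
    distinguished f g h.
Proof.
move=> guv; have V := tri_verdier C; have S := tri_shift C.
exists (- adjunct v), (scounitV W \oc u); apply/(dist_rotate V).
rewrite shift_mapN opprK.
have iso1 (A : C) : is_iso (idm A) by exists (idm A); rewrite oc1m.
apply: (dist_iso V (a := idm Y) (b := idm Z) (c := scounitV W)) guv => //.
- by exists (scounit W); rewrite (scounitK S) (scounitVK S).
- by rewrite ocm1 oc1m.
- by rewrite ocm1.
- by rewrite adjunctK (shift_map_id S) oc1m.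
Qed.

Definition triangle (C : triData) (L M R : C) : Prop :=
  exists (a : mor L M) (b : mor M R) (c : mor R (shift L)),
    distinguished a b c.

Lemma triangle_shift (C : triangulatedCategory) (L M R : C) :
  triangle L M R -> triangle (shift L) (shift M) (shift R).
Proof.
have V := tri_verdier C.
move=> [a [b [c /(dist_rotate V) /(dist_rotate V) /(dist_rotate V) abc]]].
by do 3 eexists; apply: abc.
Qed.

Lemma triangle_unshift (C : triangulatedCategory) (L M R : C) :
  triangle L M R -> triangle (unshift L) (unshift M) (unshift R).
Proof.
case=> [a [b [c]]] /dist_rotateV[? [? /dist_rotateV[? [? ]]]].
by move=> /dist_rotateV[? [? abc]]; do 3 eexists; apply: abc.
Qed.

Lemma triangle_shiftz (C : triangulatedCategory) (k : int) (L M R : C) :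
  triangle L M R -> triangle (shiftz k L) (shiftz k M) (shiftz k R).
Proof.
case: k => k LMR /=; first by elim: k => //= k; apply: triangle_shift.
by apply: triangle_unshift; elim: k => //= k; apply: triangle_unshift.
Qed.

Lemma triangle_iso (C : triangulatedCategory) (L M M' R : C) :
  isomorphic M M' -> triangle L M R -> triangle L M' R.
Proof.
have V := tri_verdier C; have S := tri_shift C.
case=> f [g [gf fg]] [a [b [c abc]]]; exists (f \oc a), (b \oc g), c.
have iso1 (A : C) : is_iso (idm A) by exists (idm A); rewrite oc1m.
apply: (dist_iso V (a := idm L) (b := f) (c := idm R)) abc => //.
- by exists g.
- by rewrite ocm1.
- by rewrite -ocA gf ocm1 oc1m.
- by rewrite ocm1 (shift_map_id S) oc1m.
Qed.

(** Left orthogonality to a given object is stable under extensions. *)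
Lemma hom_vanishes_extension (C : triangulatedCategory) (L M R Y : C) :
  triangle L M R -> hom_vanishes L Y -> hom_vanishes R Y -> hom_vanishes M Y.
Proof.
case=> a [b [c abc]] LY RY f.
by have [g ->] := dist_factor_right abc (LY (f \oc a)); rewrite (RY g) oc0m.
Qed.

(** * Torsion theories *)

Lemma lperp_retract_closed (C : triangulatedCategory) (E : set C) :
  retract_closed (lperp E).
Proof.
move=> X Y XY EY Z EZ; apply: hom_vanishes_retract XY _ (EY Z EZ).
exact/iso_retract/iso_refl.
Qed.

Lemma rperp_retract_closed (C : triangulatedCategory) (D : set C) :
  retract_closed (rperp D).
Proof.
move=> X Y XY DY Z DZ; apply: hom_vanishes_retract XY (DY Z DZ).
exact/iso_retract/iso_refl.
Qed.

(** An object orthogonal to one end of its decomposition triangle is a retract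
    of the other end; so closure under retracts upgrades orthogonality to both
    equalities in the definition of a torsion theory. *)
Lemma torsion_theoryI (C : triangulatedCategory) (LO RO : set C) :
  (forall X Y : C, LO X -> RO Y -> hom_vanishes X Y) ->
  retract_closed LO -> retract_closed RO ->
  (forall M : C, exists L R : C, [/\ LO L, RO R & triangle L M R]) ->
  torsion_theory LO RO.
Proof.
move=> orth LOr ROr dec; split.
- rewrite eqEsubset; split=> X; last by move=> RX Y LY; apply: orth.
  move=> LX; have [L [R [LL RR [a [b [c abc]]]]]] := dec X.
  have [|p pb] := dist_factor_right (f := idm X) abc.
    by rewrite (LX L LL a) ocm0.
  by apply: ROr RR; exists b, p.
- rewrite eqEsubset; split=> X; first by move=> LX Y RY; apply: orth.
  move=> RX; have [L [R [LL RR [a [b [c abc]]]]]] := dec X.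
  have [|i ai] := dist_factor_left (f := idm X) abc.
    by rewrite (RX R RR b) oc0m.
  by apply: LOr LL; exists i, a.
- move=> M; have [L [R [LL RR [a [b [c abc]]]]]] := dec M.
  by exists L, R, a, b, c.
Qed.

Lemma torsion_orth (C : triangulatedCategory) (LO RO : set C) (X Y : C) :
  torsion_theory LO RO -> LO X -> RO Y -> hom_vanishes X Y.
Proof. by case=> <- _ _ LX; apply. Qed.

Lemma torsion_retract_left (C : triangulatedCategory) (LO RO : set C) :
  torsion_theory LO RO -> retract_closed LO.
Proof. by case=> _ -> _; apply: lperp_retract_closed. Qed.

Lemma torsion_retract_right (C : triangulatedCategory) (LO RO : set C) :
  torsion_theory LO RO -> retract_closed RO.
Proof. by case=> <- _ _; apply: rperp_retract_closed. Qed.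

Lemma shift_class_retract_closed (C : triangulatedCategory) (P : set C)
  (k : int) : retract_closed P -> retract_closed (shift_class P k).
Proof.
move=> Pr X Y XY [Z PZ YZ]; exists (shiftz (- k) X).
  apply: Pr PZ; apply: (@retract_trans _ (shiftz (- k) (shiftz k Z))).
    by apply: retract_shiftz; apply: retract_trans XY (iso_retract YZ).
  by apply: iso_retract; rewrite -[X in isomorphic _ X]/(shiftz 0 Z)
    -(addNr k); apply: shiftzD.
rewrite -[X in isomorphic X _]/(shiftz 0 X) -(subrr k).
exact/iso_sym/shiftzD.
Qed.

Lemma torsion_shift (C : triangulatedCategory) (LO RO : set C) (k : int) :
  torsion_theory LO RO ->
  torsion_theory (shift_class LO k) (shift_class RO k).
Proof.
move=> tLR; apply: torsion_theoryI.
- move=> X Y [X0 LX XX] [Y0 RY YY].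
  apply: hom_vanishes_retract (iso_retract XX) (iso_retract YY) _.
  exact: hom_vanishes_shiftz (torsion_orth tLR LX RY).
- exact: shift_class_retract_closed (torsion_retract_left tLR).
- exact: shift_class_retract_closed (torsion_retract_right tLR).
move=> M; have [L [R [a [b [c [LL RR abc]]]]]] :=
  torsion_dec tLR (shiftz (- k) M).
exists (shiftz k L), (shiftz k R); split.
- by exists L => //; apply: iso_refl.
- by exists R => //; apply: iso_refl.
apply: (@triangle_iso _ _ (shiftz k (shiftz (- k) M))).
  by rewrite -[X in isomorphic _ X]/(shiftz 0 M) -(subrr k); apply: shiftzD.
by apply: triangle_shiftz; exists a, b, c.
Qed.

Lemma torsion_factors_right (C : triangulatedCategory) (LO RO : set C)
  (X Y : C) (h : mor X Y) : torsion_theory LO RO ->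
  factors_through RO h <-> (forall M : C, LO M -> annihilated_by M h).
Proof.
move=> tLR; split=> [[Z [RZ [f [g ->]]]] M LM e|null_h].
  by rewrite -ocA (torsion_orth tLR LM RZ (f \oc e)) ocm0.
have [L [R [a [b [c [LL RR abc]]]]]] := torsion_dec tLR X.
have [g hg] := dist_factor_right abc (null_h L LL a).
by exists R; split=> //; exists b, g.
Qed.

Lemma torsion_factors_left (C : triangulatedCategory) (LO RO : set C)
  (X Y : C) (h : mor X Y) : torsion_theory LO RO ->
  factors_through LO h <->
  (forall Z : C, RO Z -> forall f : mor Y Z, f \oc h = 0).
Proof.
move=> tLR; split=> [[Z [LZ [f [g ->]]]] M RM e|null_h].
  by rewrite ocA (torsion_orth tLR LZ RM (e \oc g)) oc0m.
have [L [R [a [b [c [LL RR abc]]]]]] := torsion_dec tLR Y.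
have [g hg] := dist_factor_left abc (null_h R RR b).
by exists L; split=> //; exists g, a.
Qed.

Lemma factors_through_left (C : triangulatedCategory) (P : set C) (X Y : C)
  (h : mor X Y) : P X -> factors_through P h.
Proof. by move=> PX; exists X; split=> //; exists (idm X), h; rewrite ocm1. Qed.

Lemma factors_through_right (C : triangulatedCategory) (P : set C) (X Y : C)
  (h : mor X Y) : P Y -> factors_through P h.
Proof. by move=> PY; exists Y; split=> //; exists h, (idm Y); rewrite oc1m. Qed.

Lemma torsion_projective_class (C : triangulatedCategory) (LO RO : set C) :
  torsion_theory LO RO -> projective_class LO (factors_through RO).
Proof.
move=> tLR; split.
- by move=> X Y h; apply: torsion_factors_right.
- move=> M; split=> [null_M|LM X Y h]; last first.
    by move=> /(torsion_factors_right h tLR); apply.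
  rewrite (torsion_left tLR) => Y RY f.
  by rewrite -[f]oc1m; apply: null_M; apply: factors_through_right.
- move=> M; have [L [R [a [b [c [LL RR abc]]]]]] := torsion_dec tLR M.
  by exists L, R, a, b, c; split=> //; apply: factors_through_right.
Qed.

Lemma torsion_injective_class (C : triangulatedCategory) (LO RO : set C) :
  torsion_theory LO RO -> injective_class RO (factors_through LO).
Proof.
move=> tLR; split.
- by move=> X Y h; apply: torsion_factors_left.
- move=> M; split=> [null_M|RM X Y h]; last first.
    by move=> /(torsion_factors_left h tLR); apply.
  rewrite -(torsion_right tLR) => Y LY f.
  by rewrite -[f]ocm1; apply: null_M; apply: factors_through_right.
- move=> M; have [L [R [a [b [c [LL RR abc]]]]]] := torsion_dec tLR M.
  (* The connecting map of the opposite triangle goes from R[-1] to L. *)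
  exists R, L, b, a, (adjunct c); split=> //.
    exact: factors_through_left.
  by rewrite /= adjunctK.
Qed.

(** * Weights and truncations *)

Lemma weight_torsion (C : triangulatedCategory) (w : weight_structure C)
  (k : int) : torsion_theory (w_le w k) (w_ge w (k + 1)).
Proof.
have [LO [RO [tLR _ eq_le eq_ge]]] := w_torsion w.
rewrite /w_le /w_ge eq_le eq_ge shift_classD addrK.
exact: torsion_shift.
Qed.

Lemma truncation_torsion (C : triangulatedCategory) (t : t_structure C)
  (k : int) : torsion_theory (t_ge t (k + 1)) (t_le t k).
Proof.
have [LO [RO [tLR _ eq_le eq_ge]]] := t_torsion t.
rewrite /t_le /t_ge eq_le eq_ge shift_classD.
exact: torsion_shift.
Qed.

Lemma t_ge_le (C : triangulatedCategory) (t : t_structure C) (k l : int) :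
  k <= l -> t_ge t l `<=` t_ge t k.
Proof.
move=> kl; rewrite -(subrK k l) addrC.
have : 0 <= l - k by rewrite subr_ge0.
case: (l - k) => // j _; elim: j => [|j IHj]; first by rewrite addr0.
apply: subset_trans IHj.
have [LO [RO [tLR sub eq_le eq_ge]]] := t_torsion t.
rewrite /t_ge eq_ge -addn1 PoszD addrA.
have := shift_classS (k := k + j + 1) sub.
by rewrite shift_classD addrK.
Qed.

Lemma t_ge_shift (C : triangulatedCategory) (t : t_structure C) (k : int)
  (X : C) : t_ge t k X -> t_ge t (k + 1) (shift X).
Proof.
move=> [Y tY XY]; exists Y => //.
by apply: iso_trans (iso_shift XY) _; apply: shiftz_succ.
Qed.

(** The truncation Q = t_{<= n} B of B in t_{>= m} stays in t_{>= m}, since it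
    is an extension of P[1], with P in t_{>= n+1}, by B. *)
Lemma truncation_in_range (C : triangulatedCategory) (t : t_structure C)
  (m n : int) (P B Q : C) : m <= n -> triangle P B Q ->
  t_ge t (n + 1) P -> t_ge t m B -> t_le t n Q -> t_range t m n Q.
Proof.
move=> mn [p [q [r /(dist_rotate (tri_verdier C)) qrp]]] tP tB tQ.
split=> //.
have := truncation_torsion t (m - 1); rewrite subrK => tm.
rewrite (torsion_left tm) => Y tY.
apply: (@hom_vanishes_extension _ B _ (shift P)).
- by exists q, r, (- shift_map p).
- exact: torsion_orth tm tB tY.
apply: torsion_orth tm _ tY; apply: t_ge_le (t_ge_shift tP).
by rewrite -addrA (le_trans mn)// lerDl.
Qed.

Lemma t_range_retract_closed (C : triangulatedCategory) (t : t_structure C)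
  (m n : int) : retract_closed (t_range t m n).
Proof.
move=> X Y XY [le_Y ge_Y]; split.
  exact: torsion_retract_right (truncation_torsion t n) _ _ XY le_Y.
have := truncation_torsion t (m - 1); rewrite subrK => tm.
exact: torsion_retract_left tm _ _ XY ge_Y.
Qed.

Lemma adjacent_w_ge (C : triangulatedCategory) (w : weight_structure C)
  (t : t_structure C) (k : int) : adjacent w t -> w_ge w k = t_ge t k.
Proof. by rewrite /w_ge /t_ge => ->. Qed.

Lemma w_le_range (C : triangulatedCategory) (w : weight_structure C)
  (t : t_structure C) (m n : int) (A Y : C) : adjacent w t ->
  w_le w (m - 1) A -> t_range t m n Y -> hom_vanishes A Y.
Proof.
move=> wt wA [_ tY]; apply: torsion_orth (weight_torsion w (m - 1)) wA _.
by rewrite subrK (adjacent_w_ge _ wt).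
Qed.

Lemma t_ge_range (C : triangulatedCategory) (t : t_structure C) (m n : int)
  (P Y : C) : t_ge t (n + 1) P -> t_range t m n Y -> hom_vanishes P Y.
Proof.
by move=> tP [tY _]; apply: torsion_orth (truncation_torsion t n) tP tY.
Qed.

(** The common core: a map N -> Y into the range factors through w_{>= m} N,
    and w_{>= m} N differs from its truncation, which is in the range, only by
    an object to which w_{<= n} M does not map. *)
Lemma kills_weightsP (C : triangulatedCategory) (w : weight_structure C)
  (t : t_structure C) (m n : int) (M N : C) (g : mor M N) :
  adjacent w t -> m <= n ->
  kills_weights w m n g <->
  (forall Y : C, t_range t m n Y -> forall h : mor N Y, h \oc g = 0).
Proof.
move=> wt mn; split.
  move=> [A [B [a [b [c [A' [B' [a' [b' [c' [wM wN bga]]]]]]]]]]] Y tY h.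
  case: wM => _ wB abc; case: wN => wA' _ abc'.
  have [k hk] := dist_factor_right abc' (w_le_range wt wA' tY (h \oc a')).
  have [|l ->] := dist_factor_right (f := h \oc g) abc.
    by rewrite hk -!ocA [_ \oc (_ \oc a)]ocA bga ocm0.
  move: wB; rewrite (adjacent_w_ge _ wt) => tB.
  by rewrite (t_ge_range tB tY l) oc0m.
move=> null_g.
have [A [B [a [b [c [wA wB abc]]]]]] := torsion_dec (weight_torsion w n) M.
have [A' [B' [a' [b' [c' [wA' wB' abc']]]]]] :=
  torsion_dec (weight_torsion w (m - 1)) N.
exists A, B, a, b, c, A', B', a', b', c'; split=> //.
have [P [Q [p [q [r [tP tQ pqr]]]]]] := torsion_dec (truncation_torsion t n) B'.
have QR : t_range t m n Q.
  apply: truncation_in_range mn _ tP _ tQ; first by exists p, q, r.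
  by move: wB'; rewrite subrK (adjacent_w_ge _ wt).
have [|k ->] := dist_factor_left (f := b' \oc g) pqr.
  by rewrite ocA; apply: null_g.
rewrite -ocA (torsion_orth (weight_torsion w n) wA _ (k \oc a)) ?ocm0 //.
by rewrite (adjacent_w_ge _ wt).
Qed.

Lemma without_weightsE (C : triangulatedCategory) (w : weight_structure C)
  (t : t_structure C) (m n : int) : adjacent w t -> m <= n ->
  without_weights w m n = lperp (t_range t m n).
Proof.
move=> wt mn; rewrite eqEsubset; split=> X.
  by move=> /(kills_weightsP _ wt mn) idX Y tY f; rewrite -[f]ocm1; apply: idX.
by move=> XR; apply/(kills_weightsP _ wt mn) => Y tY h; rewrite ocm1; apply: XR.
Qed.

(** The fibre L of M -> w_{>= m} M -> t_{<= n} (w_{>= m} M): the octahedral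
    axiom places L[1] between A[1] and P[1], where A = w_{<= m-1} M and
    P = t_{>= n+1} (w_{>= m} M) are both left orthogonal to the range. *)
Lemma range_decomposition (C : triangulatedCategory) (w : weight_structure C)
  (t : t_structure C) (m n : int) (M : C) : adjacent w t -> m <= n ->
  exists L R : C,
    [/\ lperp (t_range t m n) L, t_range t m n R & triangle L M R].
Proof.
move=> wt mn; have V := tri_verdier C.
have [A [B [a [b [c [wA wB abc]]]]]] :=
  torsion_dec (weight_torsion w (m - 1)) M.
have [P [Q [p [q [r [tP tQ pqr]]]]]] := torsion_dec (truncation_torsion t n) B.
have QR : t_range t m n Q.
  apply: truncation_in_range mn _ tP _ tQ; first by exists p, q, r.
  by move: wB; rewrite subrK (adjacent_w_ge _ wt).
have [W [u [v /dist_rotateV[f [h fqb]]]]] := dist_cone V (q \oc b).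
exists (unshift W), Q; split=> //; last by exists f, (q \oc b), h.
move=> Y tY; apply/hom_vanishes_shift.
have rot X1 X2 X3 f1 f2 f3 := (@dist_rotate _ V X1 X2 X3 f1 f2 f3).1.
have [x [y [xy _ _ _ _]]] :=
  dist_octahedron V (rot _ _ _ _ _ _ abc) (rot _ _ _ _ _ _ pqr)
                    (rot _ _ _ _ _ _ fqb).
apply: (@hom_vanishes_extension _ (shift A) _ (shift P)).
- by do 3 eexists; apply: xy.
- by apply/hom_vanishes_shift; apply: w_le_range wt wA tY.
- by apply/hom_vanishes_shift; apply: t_ge_range tP tY.
Qed.

Theorem theorem3p1p1 (C : triangulatedCategory)
    (w : weight_structure C) (t : t_structure C) (wt : adjacent w t)
    (m n : int) (le_mn : m <= n) :
  [/\ torsion_theory (without_weights w m n) (t_range t m n),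
      projective_class (without_weights w m n)
        (factors_through (t_range t m n)),
      injective_class (t_range t m n) (kills_weights w m n)
    & forall (M N : C) (g : mor M N),
        kills_weights w m n g <->
        factors_through (without_weights w m n) g].
Proof.
have tors : torsion_theory (without_weights w m n) (t_range t m n).
  rewrite (without_weightsE wt le_mn); apply: torsion_theoryI.
  - by move=> X Y XR RY; apply: XR.
  - exact: lperp_retract_closed.
  - exact: t_range_retract_closed.
  - by move=> M; apply: range_decomposition wt le_mn.
have kills_factor (M N : C) (g : mor M N) :
    kills_weights w m n g <-> factors_through (without_weights w m n) g.
  apply: iff_trans (kills_weightsP g wt le_mn) (iff_sym _).
  exact: torsion_factors_left.
split=> //; first exact: torsion_projective_class.
have -> : @kills_weights C w m n = factors_through (without_weights w m n).
  apply: functional_extensionality_dep => M.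
  apply: functional_extensionality_dep => N.
  by rewrite eqEsubset; split=> g /kills_factor.
exact: torsion_injective_class.
Qed.
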